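(* For all knots $K\subset S^3$, $u_1(K)\le u_2(K)\le 2u_1(K)$.
   Context: $\mathbb{S}^1=\{\omega\in\mathbb{C} : |\omega|=1\}$. Signature function: for a knot $K\subset S^3$, choose a Seifert surface $F$ with a basis of $H_1(F)$ and Seifert matrix $V_F$. Let $W_F(\omega)=(1-\omega)V_F+(1-\omega^{-1})V_F^{\sf T}$, hermitian for $\omega\in\mathbb{S}^1$ and nonsingular for all but finitely many $\omega$. $\sigma_K(\omega)$ is the two-sided average of its signature: for $\omega=e^{2\pi i t}$, $\sigma_K(\omega)=\frac12\left(\lim_{\tau\to t^+}\operatorname{sign}W_F(e^{2\pi i\tau})+\lim_{\tau\to t^-}\operatorname{sign}W_F(e^{2\pi i\tau})\right)$; it is independent of $F$ and the basis. The jump function is $J_K(e^{2\pi i t})=\frac12\left(\lim_{\tau\to t^+}\sigma_K(e^{2\pi i\tau})-\lim_{\tau\to t^-}\sigma_K(e^{2\pi i\tau})\right)$. The Alexander polynomial is $\Delta_K(x)=\det(V_F-xV_F^{\sf T})$, up to multiplication by $\pm x^k$. Classical bound: $u_1(K)=(A-a)/2$, where $A$ and $a$ are the maximum and minimum values of $\sigma_K(\omega)$ over $\omega\in\mathbb{S}^1$. New bound $u_2(K)$: for each symmetric irreducible rational factor $\delta$ of $\Delta_K(x)$ having roots on $\mathbb{S}^1$, let $\{\alpha_i\}$ be the set of all roots of $\delta$ on $\mathbb{S}^1$, let $\mathfrak{J}_\delta=\max_i|J_K(\alpha_i)|$, $\underline{\mathfrak{S}}_\delta=\min_i\sigma_K(\alpha_i)$,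 $\overline{\mathfrak{S}}_\delta=\max_i\sigma_K(\alpha_i)$, and define $\mathcal{N}_\delta$ and $\mathcal{P}_\delta$ (lower bounds for the numbers of negative to positive, respectively positive to negative, crossing changes needed to unknot $K$) by: - if $\overline{\mathfrak{S}}_\delta\ge 0$ and $\underline{\mathfrak{S}}_\delta\le\mathfrak{J}_\delta$: $\mathcal{N}_\delta=(\mathfrak{J}_\delta+\overline{\mathfrak{S}}_\delta)/2$, $\mathcal{P}_\delta=(\mathfrak{J}_\delta-\underline{\mathfrak{S}}_\delta)/2$; - if $\overline{\mathfrak{S}}_\delta\ge 0$ and $\underline{\mathfrak{S}}_\delta>\mathfrak{J}_\delta$: $\mathcal{N}_\delta=(\mathfrak{J}_\delta+\overline{\mathfrak{S}}_\delta)/2$, $\mathcal{P}_\delta=0$; - if $\overline{\mathfrak{S}}_\delta<0$ and $-\overline{\mathfrak{S}}_\delta\le\mathfrak{J}_\delta$: $\mathcal{N}_\delta=(\mathfrak{J}_\delta+\overline{\mathfrak{S}}_\delta)/2$, $\mathcal{P}_\delta=(\mathfrak{J}_\delta-\underline{\mathfrak{S}}_\delta)/2$; - if $\overline{\mathfrak{S}}_\delta<0$ and $-\overline{\mathfrak{S}}_\delta>\mathfrak{J}_\delta$: $\mathcal{N}_\delta=0$, $\mathcal{P}_\delta=(\mathfrak{J}_\delta-\underline{\mathfrak{S}}_\delta)/2$. Then $u_2(K)=\max_\delta\mathcal{N}_\delta+\max_\delta\mathcal{P}_\delta$, the two maxima being taken separately over all such $\delta$ (and equal to $0$ if there is no such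 $\delta$). *)

(* Defs.v *)
From mathcomp Require Import all_boot all_order all_algebra.
From mathcomp Require Import complex.
From mathcomp Require Import all_classical all_reals all_analysis.

Set Implicit Arguments.
Unset Strict Implicit.
Unset Printing Implicit Defensive.

Import Order.TTheory GRing.Theory Num.Theory.
Import numFieldNormedType.Exports.

Local Open Scope classical_set_scope.
Local Open Scope ring_scope.

(* A knot K in S^3 enters through a Seifert matrix V of K: for a connected
   oriented surface F with boundary K and a basis (a_i) of H_1(F),
   V_ij = lk(a_i, a_j^+).  The matrix V - V^T is the intersection form of F,
   which is unimodular because F has exactly one boundary circle; being
   skew-symmetric, it then has determinant 1.  Conversely, by Seifert's
   realization theorem, every integer matrix with this property is the Seifert
   matrix of some Seifert surface and basis of some knot.  The empty matrix
   (n = 0) is the one given by a disk bounding the unknot. *)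
Definition seifert_matrix n (V : 'M[int]_n) : Prop := \det (V - V^T) = 1.

Definition alexander_poly n (V : 'M[int]_n) : {poly int} :=
  \det (map_mx polyC V - 'X *: map_mx polyC V^T).

(* delta(x) = x^(deg delta) * delta(1/x) *)
Definition symmetric_poly (K : fieldType) (delta : {poly K}) : Prop :=
  delta = \poly_(i < size delta) delta`_((size delta).-1 - i).

Section SignatureFunction.
Variable R : realType.

(* e^(2 pi i t).  Functions on the unit circle are written as functions of t,
   the point being circle t. *)
Definition circle (t : R) : R[i] :=
  (cos (2 * pi * t) +i* sin (2 * pi * t))%C.

(* The spectral_diag of a hermitian matrix lists its (real) eigenvalues with
   multiplicity. *)
Definition signature n (A : 'M[R[i]]_n) : R :=
  \sum_(j < n) Num.sg (complex.Re (spectral_diag A 0 j)).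

(* The maximum (minimum) of S, or 0 if S is empty. *)
Definition max_of (S : set R) : R := xget 0 (S `&` ubound S).
Definition min_of (S : set R) : R := xget 0 (S `&` lbound S).

Variables (n : nat) (V : 'M[int]_n).

Definition seifert_form (w : R[i]) : 'M[R[i]]_n :=
  (1 - w) *: map_mx intr V + (1 - w^-1) *: map_mx intr V^T.

Definition sigma (t : R) : R :=
  2^-1 * (lim (signature (seifert_form (circle u)) @[u --> t^'+])
          + lim (signature (seifert_form (circle u)) @[u --> t^'-])).

Definition jump (t : R) : R :=
  2^-1 * (lim (sigma u @[u --> t^'+]) - lim (sigma u @[u --> t^'-])).

Definition u1 : R := (max_of (range sigma) - min_of (range sigma)) / 2.

(* The roots of delta on the unit circle, as the set of their parameters. *)
Definition circle_roots (delta : {poly rat}) : set R :=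
  [set t | root (map_poly ratr delta) (circle t)].

Definition admissible_factor (delta : {poly rat}) : Prop :=
  [/\ irreducible_poly delta, delta %| map_poly intr (alexander_poly V),
      symmetric_poly delta & circle_roots delta !=set0].

Definition max_jump (delta : {poly rat}) : R :=
  max_of [set `|jump t| | t in circle_roots delta].

Definition min_sigma (delta : {poly rat}) : R :=
  min_of [set sigma t | t in circle_roots delta].

Definition max_sigma (delta : {poly rat}) : R :=
  max_of [set sigma t | t in circle_roots delta].

(* The pair (N_delta, P_delta). *)
Definition crossing_bounds (delta : {poly rat}) : R * R :=
  let J := max_jump delta in
  let s := min_sigma delta in
  let S := max_sigma delta in
  if 0 <= S then
    if s <= J then ((J + S) / 2, (J - s) / 2) else ((J + S) / 2, 0)
  else
    if - S <= J then ((J + S) / 2, (J - s) / 2) else (0, (J - s) / 2).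

Definition u2 : R :=
  max_of [set (crossing_bounds delta).1 | delta in admissible_factor]
  + max_of [set (crossing_bounds delta).2 | delta in admissible_factor].

End SignatureFunction.

(* Main.v *)
Require Import Defs.
From mathcomp Require Import all_boot all_order all_algebra.
From mathcomp Require Import algebraics_fundamentals complex.
From mathcomp Require Import all_classical all_reals all_analysis.
From mathcomp Require Import ring lra.
Set Implicit Arguments.
Unset Strict Implicit.
Unset Printing Implicit Defensive.
Import Order.TTheory GRing.Theory Num.Theory.
Import numFieldNormedType.Exports.
Local Open Scope classical_set_scope.
Local Open Scope ring_scope.

(** Everything rests on one fact: along the circle, the signature of the
    Seifert form is a step function that vanishes near 1 and can change only at
    roots of the Alexander polynomial.

    The first half of the file proves that fact.  The inertia of a nonsingular
    hermitian matrix is stable under small perturbations (inertia_near).  The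
    Seifert form at e^(2 pi i t) is the real number 2 sin(pi t) times a
    hermitian matrix, the balanced form, which depends continuously on t across
    t = 0 as well and is singular exactly at the roots of the Alexander
    polynomial (seifert_form_balanced, balanced_unit).  At 1 the balanced form
    is minus its transpose, so its signature is 0 there.  The one-sided limits
    r and l of the signature therefore exist at every t, they agree off the
    roots (sides_agree), they vanish at 1 (lims_at1), and sigma = (r + l) / 2
    and jump = (r - l) / 2.

    Let A and a be the maximum and the minimum of sigma; a <= 0 <= A since
    sigma vanishes at 1.

    For u1 <= u2, suppose A > 0.  The points at which r or l equals A form a
    closed set, which is neither empty nor the whole line.  By connectedness
    it is not open, so it contains a root t of the Alexander polynomial
    (exists_break), and |jump t| + sigma t = max(r, l) = A.  The minimal
    polynomial delta of e^(2 pi i t) over the rationals is an admissible factor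
    (exists_factor), and N_delta >= |jump t| / 2 + sigma t / 2 = A / 2.
    Symmetrically, if a < 0 then P_delta' >= - a / 2 for some delta'.  When A or
    a is 0 it is enough that N_delta and P_delta are never negative.  The two
    contributions, A / 2 and - a / 2, add up to u1.

    For u2 <= 2 u1, every factor satisfies J <= (A - a) / 2, because r and l
    lie in [a, A]; hence N_delta <= ((A - a) / 2 + A) / 2 and
    P_delta <= ((A - a) / 2 - a) / 2, and these two bounds have sum A - a.

    All the maxima and minima exist because signatures of n by n hermitian
    matrices take finitely many values. *)

(** * Inertia of hermitian matrices *)

Section Inertia.
Local Open Scope sesquilinear_scope.
Variables (C : numClosedFieldType) (n : nat).
Implicit Types (A B P Q : 'M[C]_n) (a b : 'rV[C]_n) (x y : 'rV[C]_n).

Definition hform A x : C := (x *m A *m x^t*) 0 0.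

Definition npos a : nat := #|[pred j | 0 < a 0 j]|.

Lemma hform_diag P a x :
  hform (P^t* *m diag_mx a *m P) x
  = \sum_j a 0 j * `|(x *m P^t*) 0 j| ^+ 2.
Proof.
rewrite /hform; set y := x *m P^t*.
have -> : x *m (P^t* *m diag_mx a *m P) *m x^t* = y *m diag_mx a *m y^t*.
  by rewrite /y trmx_mul map_mxM trmxCK !mulmxA.
rewrite mul_mx_diag mxE; apply: eq_bigr => j _.
by rewrite !mxE normCK mulrAC mulrC [RHS]mulrC [RHS]mulrC.
Qed.

(** Dimension count: fewer than n linear conditions are imposed on x. *)
Lemma common_zeros P Q (I K : {pred 'I_n}) : (#|K| < #|I|)%N ->
  exists2 x : 'rV[C]_n, x != 0 &
    (forall j, j \notin I -> (x *m P) 0 j = 0)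
    /\ (forall j, j \in K -> (x *m Q) 0 j = 0).
Proof.
move=> ltKI.
pose M := row_mx (colsub (@enum_val _ [predC I]) P) (colsub (@enum_val _ K) Q).
have kerM : kermx M != 0.
  rewrite -mxrank_eq0 mxrank_ker subn_eq0 -ltnNge.
  apply: leq_ltn_trans (rank_leq_col M) _.
  by rewrite -[X in (_ < X)%N]card_ord -(cardC I) addnC ltn_add2r.
exists (nz_row (kermx M)); first by rewrite nz_row_eq0.
have : nz_row (kermx M) *m M = 0 by apply/sub_kermxP/nz_row_sub.
move: (nz_row _) => x; rewrite mul_mx_row => /eqP.
rewrite -row_mx0 => /eqP/eq_row_mx[xP xQ].
split=> j jI.
- have jI' : j \in [predC I] by rewrite inE.
  have := congr1 (fun M : 'rV_ _ => M 0 (enum_rank_in jI' j)) xP.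
  rewrite [RHS]mxE => <-; rewrite !mxE; apply: eq_bigr => i _.
  by rewrite mxE enum_rankK_in.
- have := congr1 (fun M : 'rV_ _ => M 0 (enum_rank_in jI j)) xQ.
  rewrite [RHS]mxE => <-; rewrite !mxE; apply: eq_bigr => i _.
  by rewrite mxE enum_rankK_in.
Qed.

(** A nonzero vector killed by the coordinates where a is nonpositive and by
    those where b is positive would give the second form a value that is both
    positive and nonpositive. *)
Lemma npos_le P a Q b : b \is a realmx ->
  (forall x, x != 0 -> (forall j, ~~ (0 < a 0 j) -> (x *m P^t*) 0 j = 0) ->
     0 < hform (Q^t* *m diag_mx b *m Q) x) ->
  (npos a <= npos b)%N.
Proof.
move=> /mxOverP breal pos; rewrite leqNgt; apply/negP => lt.
have [x x0 [xP xQ]] := common_zeros (P^t*) (Q^t*) lt.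
have := pos x x0 xP; rewrite hform_diag real_ltNge ?real0 //; last first.
  by apply: rpred_sum => j _; rewrite realM ?breal // realX ?normr_real.
case/negP; rewrite -oppr_ge0 -sumrN; apply: sumr_ge0 => j _.
have [bj|bj] := boolP (0 < b 0 j); first by rewrite xQ // normr0 expr0n mulr0 oppr0.
by rewrite -mulNr mulr_ge0 ?exprn_ge0 // oppr_ge0 real_leNgt ?real0.
Qed.

Lemma diag_pos P a x : P \in unitmx -> a \is a realmx -> x != 0 ->
  (forall j, ~~ (0 < a 0 j) -> (x *m P^t*) 0 j = 0) ->
  0 < hform (P^t* *m diag_mx a *m P) x.
Proof.
move=> Pu /mxOverP areal x0 xP; rewrite hform_diag.
have term j : 0 <= a 0 j * `|(x *m P^t*) 0 j| ^+ 2.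
  have [aj|aj] := boolP (0 < a 0 j); last by rewrite xP // normr0 expr0n mulr0.
  by rewrite mulr_ge0 ?exprn_ge0 // ltW.
rewrite lt_def sumr_ge0 // andbT; apply: contra_neq x0 => /eqP.
rewrite psumr_eq0 // => /allP sum0.
have : x *m P^t* = 0.
  apply/rowP => j; rewrite [RHS]mxE.
  have [aj|aj] := boolP (0 < a 0 j); last exact: xP.
  have /implyP /(_ isT) := sum0 j (mem_index_enum j).
  by rewrite mulf_eq0 (gt_eqF aj) expf_eq0 normr_eq0 /= => /eqP.
have P'u : P^t* \in unitmx by rewrite map_unitmx unitmx_tr.
by move=> /(congr1 (mulmx^~ (invmx (P^t*)))); rewrite mulmxK // mul0mx.
Qed.

(** Sylvester's law of inertia. *)
Lemma npos_congr P a Q b : P \in unitmx -> Q \in unitmx ->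
  a \is a realmx -> b \is a realmx ->
  P^t* *m diag_mx a *m P = Q^t* *m diag_mx b *m Q -> npos a = npos b.
Proof.
move=> Pu Qu ar br eAB; apply/eqP; rewrite eqn_leq; apply/andP; split.
- by apply: (@npos_le P a Q b) => // x x0 xP; rewrite -eAB diag_pos.
- by apply: (@npos_le Q b P a) => // x x0 xP; rewrite eAB diag_pos.
Qed.

Lemma spectral_eq A : A \is hermsymmx ->
  A = (spectralmx A)^t* *m diag_mx (spectral_diag A) *m spectralmx A.
Proof.
move=> /hermitian_normalmx /orthomx_spectralP.
by rewrite invmx_unitary ?spectral_unitarymx.
Qed.

Lemma conjmx_diagN P a :
  P^t* *m diag_mx (- a) *m P = - (P^t* *m diag_mx a *m P).
Proof.
have -> : diag_mx (- a) = - diag_mx a.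
  by apply/matrixP => i j; rewrite !mxE mulNrn.
by rewrite mulmxN mulNmx.
Qed.

Lemma realmxN a : (- a \is a realmx) = (a \is a realmx).
Proof.
by apply/mxOverP/mxOverP => ar i j; move: (ar i j); rewrite mxE realN.
Qed.

(** The signature of A is the difference of these two numbers, its rank their sum. *)
Definition inertia A : nat * nat :=
  (npos (spectral_diag A), npos (- spectral_diag A)).

Lemma inertia_congr A P a : A \is hermsymmx -> P \in unitmx ->
  a \is a realmx -> A = P^t* *m diag_mx a *m P ->
  inertia A = (npos a, npos (- a)).
Proof.
move=> Ah Pu ar eA.
have sr := hermitian_spectral_diag_real Ah.
have su : spectralmx A \in unitmx by rewrite unitarymx_unit ?spectral_unitarymx.
have eAs := spectral_eq Ah.
congr (_, _); first by apply: (npos_congr su Pu) => //; rewrite -eAs.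
apply: (npos_congr su Pu); rewrite ?realmxN //.
by rewrite !conjmx_diagN -eAs -eA.
Qed.

Lemma diagonalization A : A \is hermsymmx -> exists P a,
  [/\ P \in unitmx, a \is a realmx, A = P^t* *m diag_mx a *m P &
      inertia A = (npos a, npos (- a))].
Proof.
move=> Ah; exists (spectralmx A), (spectral_diag A); split => //.
- by rewrite unitarymx_unit ?spectral_unitarymx.
- exact: hermitian_spectral_diag_real.
- exact: spectral_eq.
Qed.

Lemma hermitianP A : reflect (A^t* = A) (A \is hermsymmx).
Proof.
by apply: (iffP (is_hermitianmxP _ _ _)); rewrite expr0 scale1r.
Qed.

Lemma hermitianN A : A \is hermsymmx -> - A \is hermsymmx.
Proof.
move=> /hermitianP eA; apply/hermitianP; rewrite -[in RHS]eA.
by apply/matrixP => i j; rewrite !mxE rmorphN.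
Qed.

Lemma hermitianZ A c : c \is Num.real -> A \is hermsymmx ->
  c *: A \is hermsymmx.
Proof.
move=> /CrealP cr /hermitianP eA; apply/hermitianP; rewrite -[in RHS]eA.
by apply/matrixP => i j; rewrite !mxE rmorphM /= cr.
Qed.

Lemma inertiaN A : A \is hermsymmx ->
  inertia (- A) = ((inertia A).2, (inertia A).1).
Proof.
move=> Ah; have [P [a [Pu ar eA ->]]] := diagonalization Ah.
rewrite (@inertia_congr _ P (- a)) ?realmxN ?hermitianN ?opprK //.
by rewrite conjmx_diagN -eA.
Qed.

Lemma inertia_tr A : A \is hermsymmx -> inertia A^T = inertia A.
Proof.
move=> Ah; have [P [a [Pu ar eA ->]]] := diagonalization Ah.
apply: (@inertia_congr _ (map_mx Num.conj P) a) => //.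
- by apply/hermitianP; rewrite -[in RHS](hermitianP _ Ah) trmxK map_trmx trmxK.
- by rewrite map_unitmx.
- rewrite eA !trmx_mul tr_diag_mx mulmxA; congr (_ *m _ *m _).
    by apply/matrixP => i j; rewrite !mxE conjCK.
  by apply/matrixP => i j; rewrite !mxE.
Qed.

Lemma inertiaZ A c : 0 < c -> A \is hermsymmx -> inertia (c *: A) = inertia A.
Proof.
move=> c0 Ah; have [P [a [Pu ar eA ->]]] := diagonalization Ah.
have cr : c \is Num.real by rewrite gtr0_real.
rewrite (@inertia_congr _ P (c *: a)) ?hermitianZ //.
- congr (_, _); apply: eq_card => j; rewrite !inE !mxE ?oppr_gt0.
    by rewrite pmulr_rgt0.
  by rewrite pmulr_rlt0.
- by apply/mxOverP => i j; rewrite mxE realM // (mxOverP ar).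
- rewrite eA scalemxAl scalemxAr; congr (_ *m _ *m _).
  by apply/matrixP => i j; rewrite !mxE mulrnAr.
Qed.

Lemma npos_add a : (npos a + npos (- a) <= n)%N.
Proof.
rewrite -[X in (_ <= X)%N]card_ord -(cardC [pred j | 0 < a 0 j]) leq_add2l.
apply/subset_leq_card/fintype.subsetP => j; rewrite !inE mxE oppr_gt0 => aj.
by rewrite (lt_gtF aj).
Qed.

Lemma npos_add_eq a : a \is a realmx -> (forall j, a 0 j != 0) ->
  (npos a + npos (- a))%N = n.
Proof.
move=> /mxOverP ar a0.
rewrite -[RHS]card_ord -(cardC [pred j | 0 < a 0 j]); congr addn.
apply: eq_card => j; rewrite !inE mxE oppr_gt0.
by rewrite real_ltNge ?real0 // le_eqVlt eq_sym (negPf (a0 j)).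
Qed.

Lemma unitary_sqnorm P x : P \is unitarymx ->
  \sum_j `|(x *m P^t*) 0 j| ^+ 2 = \sum_j `|x 0 j| ^+ 2.
Proof.
move=> Pu.
have sq (y : 'rV[C]_n) : \sum_j `|y 0 j| ^+ 2 = (y *m y^t*) 0 0.
  by rewrite mxE; apply: eq_bigr => j _; rewrite normCK !mxE.
rewrite !sq; congr (_ 0 0).
by rewrite trmx_mul map_mxM trmxCK mulmxA mulmxKtV.
Qed.

(** The estimate 2 |x_i| |x_j| <= |x_i|^2 + |x_j|^2, applied entry by entry. *)
Lemma hform_bound A x e : (forall i j, `|A i j| <= e) ->
  `|hform A x| <= e * n%:R * \sum_j `|x 0 j| ^+ 2.
Proof.
move=> Ae.
have -> : hform A x = \sum_j \sum_i x 0 i * A i j * (x 0 j)^*.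
  rewrite /hform mxE; apply: eq_bigr => j _; rewrite !mxE mulr_suml.
  by apply: eq_bigr => i _.
apply: le_trans (ler_norm_sum _ _ _) _.
have -> : e * n%:R * (\sum_j `|x 0 j| ^+ 2)
    = \sum_j \sum_i e * (2^-1 * (`|x 0 i| ^+ 2 + `|x 0 j| ^+ 2)).
  set S := \sum_(j < n) `|x 0 j| ^+ 2; rewrite -mulrA.
  transitivity (\sum_(j < n) e * (2^-1 * (S + `|x 0 j| ^+ 2 *+ n))).
    rewrite -!mulr_sumr; congr (_ * _).
    rewrite big_split /= sumr_const card_ord sumrMnl -/S.
    rewrite -mulr2n mulrnAr -mulrnAl -[2^-1 *+ 2]mulr_natr.
    by rewrite mulVf ?pnatr_eq0 // mul1r mulr_natl.
  apply: eq_bigr => j _; rewrite -!mulr_sumr; congr (_ * (_ * _)).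
  by rewrite big_split /= sumr_const card_ord.
apply: ler_sum => j _; apply: le_trans (ler_norm_sum _ _ _) _.
apply: ler_sum => i _.
rewrite !normrM norm_conjC mulrAC mulrC.
apply: ler_pM; rewrite ?mulr_ge0 //.
set p := `|_|; set q := `|x 0 j|.
rewrite -(@ler_pM2l _ 2) ?ltr0n // mulVKf ?pnatr_eq0 // -subr_ge0.
have -> : p ^+ 2 + q ^+ 2 - 2 * (p * q) = (p - q) ^+ 2.
  by rewrite sqrrB mulr_natl addrAC.
by rewrite -realEsqr rpredB ?normr_real.
Qed.

(** Let c bound the absolute values of the eigenvalues of A from below.  A
    perturbation with entries at most c / (n + 1) changes the form at x by less
    than c |x|^2, so it keeps the form definite on the positive and on the
    negative spectral subspace of A.  Neither entry of the inertia can then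
    decrease, and both are kept since they already add up to n. *)
Lemma inertia_near A : A \is hermsymmx -> A \in unitmx ->
  exists2 e : C, 0 < e & forall B, B \is hermsymmx ->
    (forall i j, `|B i j - A i j| <= e) ->
    inertia B = inertia A.
Proof.
move=> Ah Au; set a := spectral_diag A; set P := spectralmx A.
have ar : a \is a realmx by exact: hermitian_spectral_diag_real.
have Pu : P \is unitarymx by exact: spectral_unitarymx.
have eA : A = P^t* *m diag_mx a *m P by exact: spectral_eq.
have a0 j : a 0 j != 0.
  move: Au; rewrite eA !unitmx_mul => /andP[/andP[_ +] _].
  by rewrite unitmxE det_diag unitfE => /prodf_neq0; apply.
(* The order of C is only partial, so this replaces the minimum of the `|a_j|. *)
pose c := (1 + \sum_j `|a 0 j|^-1)^-1.
have s0 : 0 < 1 + \sum_j `|a 0 j|^-1.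
  by rewrite ltr_pwDl ?ltr01 // sumr_ge0 // => j _; rewrite invr_ge0.
have c0 : 0 < c by rewrite invr_gt0.
have ca j : c <= `|a 0 j|.
  rewrite -[leRHS]invrK lef_pV2 ?posrE ?invr_gt0 ?normr_gt0 //.
  rewrite (bigD1 j) //= addrCA lerDl addr_ge0 ?ler01 //.
  by apply: sumr_ge0 => i _; rewrite ?invr_ge0.
(* Used twice: for A and B, and for their opposites. *)
have key (d : 'rV[C]_n) A' B (Q : 'M[C]_n) b :
    d \is a realmx -> (forall j, c <= `|d 0 j|) ->
    A' = P^t* *m diag_mx d *m P -> B = Q^t* *m diag_mx b *m Q ->
    b \is a realmx ->
    (forall i j, `|B i j - A' i j| <= c / n.+1%:R) -> (npos d <= npos b)%N.
  move=> /mxOverP dr cd eA' eB br near.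
  apply: (@npos_le P d Q b) => // x x0 xP; rewrite -eB.
  set S := \sum_j `|x 0 j| ^+ 2.
  have S0 : 0 < S.
    rewrite lt_def sumr_ge0 ?andbT; last by move=> j _; rewrite exprn_ge0.
    apply: contra_neq x0 => /eqP; rewrite psumr_eq0; last first.
      by move=> j _; rewrite exprn_ge0.
    move=> /allP sum0; apply/rowP => j; rewrite [RHS]mxE.
    have /implyP /(_ isT) := sum0 j (mem_index_enum j).
    by rewrite expf_eq0 normr_eq0 /= => /eqP.
  have lA : c * S <= hform A' x.
    rewrite eA' hform_diag /S -(unitary_sqnorm x Pu) mulr_sumr.
    apply: ler_sum => j _.
    have [dj|dj] := boolP (0 < d 0 j); last by rewrite xP // normr0 expr0n !mulr0.
    by rewrite ler_wpM2r ?exprn_ge0 // (le_trans (cd j)) // gtr0_norm.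
  have lE : `|hform (B - A') x| <= c / n.+1%:R * n%:R * S.
    by apply: hform_bound => i j; rewrite !mxE.
  have eBA : hform B x = hform A' x + hform (B - A') x.
    by rewrite -[in LHS](subrK A' B) addrC /hform mulmxDr mulmxDl mxE.
  have hr (D : 'rV[C]_n) (Q' : 'M[C]_n) : D \is a realmx ->
      hform (Q'^t* *m diag_mx D *m Q') x \is Num.real.
    move=> /mxOverP Dr; rewrite hform_diag rpred_sum // => j _.
    by rewrite realM ?Dr // realX ?normr_real.
  have rE : hform (B - A') x \is Num.real.
    have -> : hform (B - A') x = hform B x - hform A' x by rewrite eBA addrAC subrr add0r.
    by rewrite realB // ?eB ?eA' hr //; apply/mxOverP.
  rewrite eBA; apply: (@lt_le_trans _ _ (c * S - c / n.+1%:R * n%:R * S)).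
    rewrite -mulrBl mulr_gt0 // -mulrA -{1}[c]mulr1 -mulrBr mulr_gt0 //.
    by rewrite subr_gt0 mulrC ltr_pdivrMr ?ltr0n // mul1r ltr_nat.
  by rewrite lerD // lerNl; apply: le_trans lE; rewrite -normrN real_ler_norm ?realN.
exists (c / n.+1%:R) => [|B Bh near]; first by rewrite divr_gt0 ?ltr0n.
have br := hermitian_spectral_diag_real Bh.
have eB := spectral_eq Bh.
have l1 := key _ _ _ _ _ ar ca eA eB br near.
have l2 : (npos (- a) <= npos (- spectral_diag B))%N.
  apply: (key _ (- A) (- B) (spectralmx B)); rewrite ?realmxN //.
  - by move=> j; rewrite mxE normrN.
  - by rewrite conjmx_diagN -eA.
  - by rewrite conjmx_diagN -eB.
  - by move=> i j; rewrite !mxE -opprD normrN.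
have := npos_add_eq ar a0; have := npos_add (spectral_diag B).
rewrite /inertia -/a; move: l1 l2; move: (npos a) (npos (- a)).
move: (npos (spectral_diag B)) (npos (- spectral_diag B)) => p' q' p q.
move=> l1 l2 l3 l4; congr (_, _); apply/eqP; rewrite eqn_leq ?l1 ?l2 andbT.
  by rewrite -(leq_add2r q) l4 (leq_trans _ l3) // leq_add2l.
by rewrite -(leq_add2l p) l4 (leq_trans _ l3) // leq_add2r.
Qed.
End Inertia.

(** * Step functions on the line *)

Section StepFunctions.
Variable R : realType.
Implicit Types (t u v a b : R) (P : R -> Prop).

(** The trace of P on I is both open and closed in I. *)
Lemma connected_transport (I : set R) P : connected I ->
  (forall x, I x -> P x -> \forall y \near x, P y) ->
  (forall x, I x -> ~ P x -> \forall y \near x, ~ P y) ->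
  forall x y, I x -> I y -> P x -> P y.
Proof.
move=> cI opP opN x y Ix Iy Px.
suff IPI : I `&` [set z | P z] = I by move: Iy; rewrite -IPI => -[].
apply: cI.
- by exists x.
- exists (interior [set z | P z]); first exact: open_interior.
  apply/seteqP; split=> z [Iz Pz]; split=> //; first exact: opP.
  exact: nbhs_singleton Pz.
- exists (~` interior [set z | ~ P z]).
    exact/open_closedC/open_interior.
  apply/seteqP; split=> z [Iz Pz]; split=> //.
    by move=> /nbhs_singleton; apply.
  by apply: contrapT => NP; apply: Pz; exact: opN.
Qed.

Lemma locally_constant_itv (T : Type) (f : R -> T) a b :
  (forall u, a < u < b -> \forall v \near u, f v = f u) ->
  forall u v, a < u < b -> a < v < b -> f v = f u.
Proof.
move=> fl u v uab vab.
have cI : connected [set` `]a, b[] by apply/connected_intervalP/interval_is_interval.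
apply: (@connected_transport [set` `]a, b[] (fun w => f w = f u) cI) => //=.
- move=> x; rewrite in_itv /= => /fl fx <-; exact: fx.
- move=> x; rewrite in_itv /= => /fl fx ne.
  by apply: filterS fx => w ->.
- by rewrite in_itv.
Qed.

Lemma near_right_near t P : (\forall u \near t^'+, P u) ->
  \forall u \near t^'+, \forall v \near u, P v.
Proof.
rewrite !near_withinE => /near_join; apply: filterS => u Pu tu.
by apply: filterS2 (lt_nbhsr tu) Pu => v tv; apply.
Qed.

Lemma near_left_near t P : (\forall u \near t^'-, P u) ->
  \forall u \near t^'-, \forall v \near u, P v.
Proof.
rewrite !near_withinE => /near_join; apply: filterS => u Pu tu.
by apply: filterS2 (lt_nbhsl tu) Pu => v tv; apply.
Qed.

Lemma near_two_sided t P : (\forall u \near t^'-, P u) -> P t ->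
  (\forall u \near t^'+, P u) -> \forall u \near t, P u.
Proof.
rewrite !near_withinE => Pl Pt; apply: filterS2 Pl => u Pl Pr.
by have [/Pl|/Pr|->] := ltgtP u t.
Qed.

Lemma near_dnbhs_sides t P : (\forall u \near t^', P u) ->
  (\forall u \near t^'-, P u) /\ (\forall u \near t^'+, P u).
Proof.
rewrite !near_withinE => Pt; split; apply: filterS Pt => u Pu ut; apply: Pu => /=.
  by rewrite lt_eqF.
by rewrite gt_eqF.
Qed.

Variable f : R -> R.

Definition rlim t : R := lim (f u @[u --> t^'+]).
Definition llim t : R := lim (f u @[u --> t^'-]).
Definition midvalue t : R := 2^-1 * (rlim t + llim t).

Lemma rlim_cst t c : (\forall u \near t^'+, f u = c) -> rlim t = c.
Proof. exact: norm_lim_near_cst. Qed.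

Lemma llim_cst t c : (\forall u \near t^'-, f u = c) -> llim t = c.
Proof. exact: norm_lim_near_cst. Qed.

Lemma lims_cst t c : (\forall u \near t, f u = c) -> rlim t = c /\ llim t = c.
Proof.
move=> fc; split; [apply: rlim_cst|apply: llim_cst];
  by rewrite near_withinE; apply: filterS fc.
Qed.

(** The breaks of f are isolated points. *)
Hypothesis f_step : forall t, \forall u \near t^', \forall v \near u, f v = f u.

Lemma rlimP t : \forall u \near t^'+, f u = rlim t.
Proof.
have := f_step t; rewrite near_withinE => /nbhs_ballP[e /= e0 fe].
have te : t < t + e / 2 < t + e.
  by rewrite ltrDl divr_gt0 //= ltrD2l ltr_pdivrMr // mulrDr mulr1 ltrDl.
have fc u : t < u < t + e -> f u = f (t + e / 2).
  move=> ut; apply: (@locally_constant_itv _ f t (t + e)) => // w /andP[tw we].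
  apply: fe => /=; last by rewrite gt_eqF.
  by rewrite /ball /= ltr0_norm ?subr_lt0 // opprB ltrBlDl.
have fr : \forall u \near t^'+, f u = f (t + e / 2).
  near=> u; apply: fc; apply/andP; split; near: u; first exact: nbhs_right_gt.
  by apply: nbhs_right_lt; rewrite ltrDl.
by rewrite (rlim_cst fr).
Unshelve. all: by end_near. Qed.

Lemma llimP t : \forall u \near t^'-, f u = llim t.
Proof.
have := f_step t; rewrite near_withinE => /nbhs_ballP[e /= e0 fe].
have te : t - e < t - e / 2 < t.
  by rewrite gtrBl divr_gt0 // andbT ltrD2l ltrN2 ltr_pdivrMr // mulrDr mulr1 ltrDl.
have fc u : t - e < u < t -> f u = f (t - e / 2).
  move=> ut; apply: (@locally_constant_itv _ f (t - e) t) => // w /andP[tw we].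
  apply: fe => /=; last by rewrite lt_eqF.
  by rewrite /ball /= gtr0_norm ?subr_gt0 // ltrBlDl -ltrBlDr.
have fr : \forall u \near t^'-, f u = f (t - e / 2).
  near=> u; apply: fc; apply/andP; split; near: u; last exact: nbhs_left_lt.
  by apply: nbhs_left_gt; rewrite gtrBl.
by rewrite (llim_cst fr).
Unshelve. all: by end_near. Qed.

Lemma lims_near_right t :
  \forall u \near t^'+, rlim u = rlim t /\ llim u = rlim t.
Proof. by apply: filterS (near_right_near (rlimP t)) => u /lims_cst. Qed.

Lemma lims_near_left t :
  \forall u \near t^'-, rlim u = llim t /\ llim u = llim t.
Proof. by apply: filterS (near_left_near (llimP t)) => u /lims_cst. Qed.

Let halfD c : 2^-1 * (c + c) = c :> R.
Proof. by rewrite -mulr2n -[c *+ 2]mulr_natl mulKf ?pnatr_eq0. Qed.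

Lemma midvalue_near_right t : \forall u \near t^'+, midvalue u = rlim t.
Proof.
by apply: filterS (lims_near_right t) => u [ru lu]; rewrite /midvalue ru lu halfD.
Qed.

Lemma midvalue_near_left t : \forall u \near t^'-, midvalue u = llim t.
Proof.
by apply: filterS (lims_near_left t) => u [ru lu]; rewrite /midvalue ru lu halfD.
Qed.

Lemma rlim_midvalue t : exists u, midvalue u = rlim t.
Proof. exact: (@filter_ex _ t^'+ _ _ (midvalue_near_right t)). Qed.

Lemma llim_midvalue t : exists u, midvalue u = llim t.
Proof. exact: (@filter_ex _ t^'- _ _ (midvalue_near_left t)). Qed.

Lemma lim_midvalue_right t : lim (midvalue u @[u --> t^'+]) = rlim t.
Proof. exact/norm_lim_near_cst/midvalue_near_right. Qed.

Lemma lim_midvalue_left t : lim (midvalue u @[u --> t^'-]) = llim t.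
Proof. exact/norm_lim_near_cst/midvalue_near_left. Qed.

(** The points where a one-sided limit equals c form a closed set.  If it
    avoided S it would also be open, hence the whole line as it contains t1,
    against the hypotheses on t0. *)
Lemma exists_break (S : set R) c t0 t1 :
  (forall t, ~ S t -> rlim t = llim t) ->
  rlim t0 <> c -> llim t0 <> c -> rlim t1 = c ->
  exists t, S t /\ (rlim t = c \/ llim t = c).
Proof.
move=> offS r0 l0 r1; apply: contrapT => /forallNP noS.
suff : rlim t0 = c \/ llim t0 = c by case.
pose P t := rlim t = c \/ llim t = c.
apply: (@connected_transport [set: R] P _ _ _ t1 t0) => //; last by left.
- by apply/connected_intervalP => ? ? _ _ ? _.
- move=> t _ Pt; have St : ~ S t by move=> St; apply: (noS t).
  have [rt lt] : rlim t = c /\ llim t = c.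
    by have := offS t St; case: Pt => -> // <-.
  apply: (near_two_sided _ Pt).
    by apply: filterS (lims_near_left t) => u [ru _]; left; rewrite ru.
  by apply: filterS (lims_near_right t) => u [ru _]; left; rewrite ru.
- move=> t _ Pt; apply: (near_two_sided _ Pt).
    apply: filterS (lims_near_left t) => u [ru lu].
    by rewrite /P ru lu => Pu; apply: Pt; right; case: Pu.
  apply: filterS (lims_near_right t) => u [ru lu].
  by rewrite /P ru lu => Pu; apply: Pt; left; case: Pu.
Qed.
End StepFunctions.

(** * The signature over the complex numbers *)

Section Signature.
Local Open Scope sesquilinear_scope.
Variables (R : realType) (n : nat).
Implicit Types A B : 'M[R[i]]_n.

Lemma conj_real (r : R) : (r%:C%C)^* = r%:C%C.
Proof. by apply/eqP; rewrite eq_complex /= oppr0 !eqxx. Qed.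

Lemma natr_npos (a : 'rV[R[i]]_n) : (npos a)%:R = \sum_j (0 < a 0 j)%R%:R :> R.
Proof.
rewrite /npos -sum1_card natr_sum big_mkcond; apply: eq_bigr => j _.
by rewrite inE; case: ifP.
Qed.

Lemma signatureE A : A \is hermsymmx ->
  signature A = (inertia A).1%:R - (inertia A).2%:R.
Proof.
move=> /hermitian_spectral_diag_real /mxOverP sr.
rewrite !natr_npos -sumrB; apply: eq_bigr => j _.
rewrite mxE -(RRe_real (sr 0 j)); set r := complex.Re _.
by rewrite -rmorphN !ltcR /= oppr_gt0; case: sgrP => _; rewrite ?subr0 ?sub0r.
Qed.

Lemma signatureN A : A \is hermsymmx -> signature (- A) = - signature A.
Proof.
by move=> Ah; rewrite (signatureE Ah) (signatureE (hermitianN Ah)) inertiaN //= opprB.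
Qed.

Lemma signature_tr A : A \is hermsymmx -> signature A^T = signature A.
Proof.
move=> Ah; have Th : A^T \is hermsymmx.
  by apply/hermitianP; rewrite -[in RHS](hermitianP _ Ah) trmxK map_trmx trmxK.
by rewrite (signatureE Ah) (signatureE Th) inertia_tr.
Qed.

Lemma signature_scale A (c : R) : c != 0 -> A \is hermsymmx ->
  signature (c%:C%C *: A) = Num.sg c * signature A.
Proof.
have pos B (d : R) : 0 < d -> B \is hermsymmx -> signature (d%:C%C *: B) = signature B.
  move=> d0 Bh; have d0' : (0 : R[i]) < d%:C%C.
    by rewrite -(rmorph0 (@real_complex R)) ltcR.
  have dBh := hermitianZ (gtr0_real d0') Bh.
  by rewrite (signatureE dBh) (inertiaZ d0' Bh) (signatureE Bh).
move=> + Ah; case: (ltgtP c 0) => // [c0|c0] _.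
  rewrite (ltr0_sg c0) mulN1r -(signatureN Ah).
  rewrite -[in LHS](opprK c) rmorphN scaleNr -scalerN.
  by rewrite pos ?oppr_gt0 ?hermitianN.
by rewrite (gtr0_sg c0) mul1r pos.
Qed.

Lemma signature_near A : A \is hermsymmx -> A \in unitmx ->
  exists2 e : R, 0 < e & forall B, B \is hermsymmx ->
    (forall i j, `|B i j - A i j| <= e%:C%C) -> signature B = signature A.
Proof.
move=> Ah Au; have [e e0 near] := inertia_near Ah Au.
have ee : (complex.Re e)%:C%C = e by rewrite RRe_real ?gtr0_real.
exists (complex.Re e); first by rewrite -ltcR ee.
move=> B Bh BA; rewrite (signatureE Ah) (signatureE Bh) near // => i j.
by rewrite -ee.
Qed.

Definition signature_values : set R :=
  [set k%:R - l%:R | k in `I_n.+1 & l in `I_n.+1].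

Lemma finite_signature_values : finite_set signature_values.
Proof. by apply: finite_image2; exact: finite_II. Qed.

Lemma signature_in_values A : A \is hermsymmx -> signature_values (signature A).
Proof.
move=> /signatureE ->; have le := npos_add (spectral_diag A).
exists (inertia A).1; first by rewrite /= ltnS (leq_trans (leq_addr _ _) le).
exists (inertia A).2 => //.
by rewrite /= ltnS (leq_trans (leq_addl _ _) le).
Qed.
End Signature.

(** * The Seifert form as a real multiple of a balanced form *)

Section Balanced.
Local Open Scope sesquilinear_scope.
Variables (R : realType) (n : nat) (V : 'M[int]_n).
Implicit Types t u v : R.

(** - i e^(i pi u), the direction of 1 - e^(2 pi i u). *)
Definition zeta u : R[i] := (sin (pi * u) -i* cos (pi * u))%C.

(** The quotient of the Seifert form at e^(2 pi i u) by 2 sin(pi u), extended by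
    continuity to the integers u, where both vanish. *)
Definition balanced_form u : 'M[R[i]]_n :=
  zeta u *: map_mx intr V + (zeta u)^* *: map_mx intr V^T.

Definition alexander_complex : {poly R[i]} := map_poly intr (alexander_poly V).

Lemma norm_zeta u : `|zeta u| = 1.
Proof. by rewrite normc_def /= sqrrN sin2cos2 subrK sqrtr1. Qed.

Lemma norm_circle u : `|circle u| = 1.
Proof. by rewrite normc_def /= cos2Dsin2 sqrtr1. Qed.

Let double u : 2 * pi * u = (pi * u) *+ 2.
Proof. by rewrite mulr2n; ring. Qed.

Lemma circle_zeta u : 1 - circle u = (2 * sin (pi * u))%:C%C * zeta u.
Proof.
apply/eqP; rewrite eq_complex /= double cos_mulr2n sin_mulr2n.
have := cos2Dsin2 (pi * u); set s := sin _; set c := cos _ => cs.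
by apply/andP; split; apply/eqP; rewrite !mul0r ?subr0 ?addr0; lra.
Qed.

Lemma circle_inv u : (circle u)^-1 = (circle u)^*.
Proof. by rewrite invC_norm norm_circle expr1n invr1 mul1r. Qed.

Lemma seifert_form_balanced u :
  seifert_form V (circle u) = (2 * sin (pi * u))%:C%C *: balanced_form u.
Proof.
rewrite /seifert_form /balanced_form scalerDr !scalerA -circle_zeta.
congr (_ + _ *: _).
by rewrite circle_inv -[in RHS](conj_real (2 * _)) -rmorphM -circle_zeta rmorphB rmorph1.
Qed.

Lemma conj_zeta u : (zeta u)^* = - (circle u)^* * zeta u.
Proof.
have e : - (circle u)^* = (zeta u)^* ^+ 2.
  apply/eqP; rewrite expr2 eq_complex /= double cos_mulr2n sin_mulr2n.
  have := cos2Dsin2 (pi * u); set s := sin _; set c := cos _ => cs.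
  by apply/andP; split; apply/eqP; lra.
by rewrite e expr2 -mulrA [X in _ * X]mulrC -normCK norm_zeta expr1n mulr1.
Qed.

Lemma conj_int (m : int) : (m%:~R : R[i])^* = m%:~R.
Proof. exact: rmorph_int. Qed.

Lemma balanced_herm u : balanced_form u \is hermsymmx.
Proof.
apply/hermitianP; apply/matrixP => i j.
by rewrite !mxE rmorphD !rmorphM /= conjCK !conj_int addrC.
Qed.

(** The determinant commutes with evaluation. *)
Lemma alexander_horner (w : R[i]) :
  alexander_complex.[w] = \det (map_mx intr V - w *: map_mx intr V^T).
Proof.
rewrite /alexander_complex /alexander_poly -det_map_mx /=.
rewrite -horner_evalE -det_map_mx.
congr (\det _); apply/matrixP => i j; rewrite !mxE /= /horner_eval.
rewrite rmorphB rmorphM /= map_polyX !map_polyC /=.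
by rewrite hornerD hornerN hornerM !hornerC hornerX.
Qed.

Lemma alexander_conj (w : R[i]) :
  alexander_complex.[w^*] = (alexander_complex.[w])^*.
Proof.
rewrite -horner_map; congr (_.[_]).
rewrite /alexander_complex -map_poly_comp; apply: eq_map_poly => m /=.
by rewrite conj_int.
Qed.

(** The balanced form is zeta u times V - w^-1 V^T for w = e^(2 pi i u), and
    w^-1 is the conjugate of w, which is a root exactly when w is. *)
Lemma balanced_unit u : ~~ root alexander_complex (circle u) ->
  balanced_form u \in unitmx.
Proof.
rewrite rootE => nr.
have -> : balanced_form u =
    zeta u *: (map_mx intr V - (circle u)^* *: map_mx intr V^T).
  rewrite /balanced_form conj_zeta scalerDr scalerN scalerA mulNr scaleNr.
  by rewrite [X in _ - X *: _]mulrC.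
rewrite unitmxE detZ -alexander_horner alexander_conj unitfE mulf_neq0 //.
  by rewrite expf_neq0 // -normr_gt0 norm_zeta.
by rewrite conjC_eq0.
Qed.
End Balanced.

(** * Parameters of points of the circle *)

Section CircleTopology.
Variable R : realType.
Implicit Types t u v : R.

(** Equal points give cos(2 pi (u - t)) = 1, that is sin(pi (u - t)) = 0. *)
Lemma circle_inj_near t u : `|u - t| < 2^-1 -> circle u = circle t -> u = t.
Proof.
move=> ut /eqP; rewrite eq_complex /= => /andP[/eqP ec /eqP es].
have c1 : cos (2 * pi * (u - t)) = 1.
  by rewrite mulrBr cosB ec es -!expr2 cos2Dsin2.
have s0 : sin (pi * (u - t)) = 0.
  move: c1; have -> : 2 * pi * (u - t) = (pi * (u - t)) *+ 2 by rewrite mulr2n; ring.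
  rewrite cos_mulr2n cos2sin2 => h; apply/eqP; rewrite -sqrf_eq0; apply/eqP.
  by move: h; rewrite mulr2n; lra.
have p0 := pi_gt0 R.
have noroot (d : R) : 0 < d -> d < 2^-1 -> sin (pi * d) <> 0.
  move=> d0 d1; apply/eqP; rewrite gt_eqF // sin_gt0_pi // mulr_gt0 //=.
  by rewrite -[ltRHS]mulr1 ltr_pM2l //; lra.
move: ut; rewrite ltr_norml => /andP[ut1 ut2].
case: (ltgtP (u - t) 0) => d0; last by lra.
- by exfalso; apply: (noroot (t - u)); [lra | lra | rewrite -opprB mulrN sinN s0 oppr0].
- by exfalso; apply: (noroot (u - t)).
Qed.

(** At most one parameter at distance less than 1/4 of t can represent w. *)
Lemma circle_avoids t (w : R[i]) : \forall u \near t^', circle u != w.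
Proof.
have near_t : \forall u \near t^', `|u - t| < 2^-1 / 2.
  apply: nbhs_dnbhs; apply/nbhs_ballP; exists (2^-1 / 2); first by rewrite /= !divr_gt0.
  by move=> u; rewrite /ball /= distrC.
have [[u0 [u0t cu0]]|no] := pselect (exists u, `|u - t| < 2^-1 / 2 /\ circle u = w).
  have neq_u0 : \forall u \near t^', u != u0.
    have [->|tu0] := eqVneq u0 t; first exact: nbhs_dnbhs_neq.
    apply: nbhs_dnbhs; case: (ltgtP t u0) tu0 => // lt _.
      by apply: filterS (lt_nbhsl lt) => u /lt_eqF ->.
    by apply: filterS (lt_nbhsr lt) => u /gt_eqF ->.
  apply: filterS2 near_t neq_u0 => u ut neq.
  apply: contra_neq neq => cu; apply: circle_inj_near; last by rewrite cu.
  rewrite -(subrK t u) -addrA (le_lt_trans (ler_normD _ _)) // [ltRHS](splitr 2^-1).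
  by rewrite ltrD // distrC.
by apply: filterS near_t => u ut; apply/eqP => cu; apply: no; exists u.
Qed.

Lemma circle_roots_isolated (p : {poly R[i]}) t : p != 0 ->
  \forall u \near t^', ~~ root p (circle u).
Proof.
move=> p0; have [r rE] := closed_field_poly_normal p.
have : \forall u \near t^', circle u \notin r.
  elim: (r) => [|w s IH]; first by apply: filterE => u; rewrite in_nil.
  apply: filterS2 IH (circle_avoids t w) => u; rewrite in_cons negb_or => -> ->.
  by [].
apply: filterS => u; rewrite rE rootZ ?lead_coef_eq0 //.
by rewrite root_prod_XsubC.
Qed.
End CircleTopology.

(** * The signature along the circle *)

Section SeifertSignature.
Local Open Scope sesquilinear_scope.
Variables (R : realType) (n : nat) (V : 'M[int]_n).
Hypothesis hV : seifert_matrix V.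
Implicit Types t u v : R.

Definition form_signature u : R := signature (seifert_form V (circle u)).

Let D : {poly R[i]} := alexander_complex R V.

(** This is where the unimodularity of V - V^T enters. *)
Lemma alexander_at1 : D.[1] = 1.
Proof.
rewrite alexander_horner scale1r -map_mxB det_map_mx.
by have -> : \det (V - V^T) = 1 by exact: hV.
Qed.

Lemma alexander_neq0 : D != 0.
Proof.
by apply: contra_eq_neq alexander_at1 => ->; rewrite horner0 eq_sym oner_eq0.
Qed.

Lemma sin_neq0 t : circle t != 1 -> sin (pi * t) != 0.
Proof.
apply: contra_neq => s0; apply/eqP; rewrite eq_sym -subr_eq0 circle_zeta s0.
by rewrite mulr0 rmorph0 mul0r.
Qed.

Lemma scaled_cvg (f : R -> R) : continuous f ->
  forall t, f (pi * u) @[u --> t] --> f (pi * t).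
Proof.
move=> cf t; apply: (@continuous_comp _ _ _ (fun u => pi * u) f); last exact: cf.
exact: mulrl_continuous.
Qed.

Lemma zeta_near t (e : R) : 0 < e ->
  \forall u \near t, `|zeta u - zeta t| <= e%:C%C.
Proof.
move=> e0.
have e20 : 0 < e / 2 by rewrite divr_gt0.
have cs : \forall u \near t, `|sin (pi * t) - sin (pi * u)| < e / 2.
  exact: (cvgr_dist_lt _ _ (@scaled_cvg sin (@continuous_sin R) t) _ e20).
have cc : \forall u \near t, `|cos (pi * t) - cos (pi * u)| < e / 2.
  exact: (cvgr_dist_lt _ _ (@scaled_cvg cos (@continuous_cos R) t) _ e20).
apply: filterS2 cs cc => u; rewrite distrC => su; rewrite distrC => cu.
rewrite normc_def lecR /= opprK.
set s := sin _ - _; set c := - cos _ + _.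
have -> : s ^+ 2 + c ^+ 2 = `|s| ^+ 2 + `|c| ^+ 2 by rewrite !real_normK ?num_real.
have cE : `|c| < e / 2 by rewrite /c addrC -opprB normrN.
rewrite -[leRHS](gtr0_norm e0) -[`|e|]sqrtr_sqr ler_wsqrtr //.
have := normr_ge0 s; have := normr_ge0 c; move: su cE; rewrite -/s.
by move: `|s| `|c| => a b; nra.
Qed.

Lemma balanced_formE u i j : balanced_form V u i j =
  zeta u * (V i j)%:~R + (zeta u)^* * (V j i)%:~R.
Proof. by do 6 rewrite mxE. Qed.

Lemma balanced_near t (e : R) : 0 < e -> \forall u \near t,
  forall i j, `|balanced_form V u i j - balanced_form V t i j| <= e%:C%C.
Proof.
move=> e0.
pose close i j u := `|balanced_form V u i j - balanced_form V t i j| <= e%:C%C.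
apply: (@filter_forall _ _ (fun i u => forall j, close i j u) _ (nbhs_filter t)) => i.
apply: (@filter_forall _ _ (close i) _ (nbhs_filter t)) => j; rewrite /close.
pose a : R := (`|V i j| + `|V j i|)%:~R.
have a0 : 0 <= a by rewrite ler0z addr_ge0.
have d0 : 0 < e / (a + 1) by rewrite divr_gt0 // ltr_wpDl.
apply: filterS (zeta_near t d0) => u zu.
have -> : balanced_form V u i j - balanced_form V t i j =
    (zeta u - zeta t) * (V i j)%:~R + (zeta u - zeta t)^* * (V j i)%:~R.
  rewrite rmorphB !mulrBl addrACA -opprD.
  by congr (_ - _); exact: balanced_formE.
apply: le_trans (ler_normD _ _) _.
rewrite !normrM norm_conjC -mulrDr -!intr_norm -intrD.
have -> : (`|V i j| + `|V j i|)%:~R = a%:C%C :> R[i] by rewrite /a rmorph_int.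
apply: le_trans (ler_wpM2r _ zu) _; first by rewrite -(rmorph0 (@real_complex R)) lecR.
rewrite -rmorphM lecR -mulrA ler_piMr ?(ltW e0) // mulrC.
by rewrite ler_pdivrMr ?ltr_wpDl // mul1r lerDl.
Qed.

Lemma balanced_signature_near t : ~~ root D (circle t) ->
  \forall u \near t, signature (balanced_form V u) = signature (balanced_form V t).
Proof.
move=> nr.
have [e e0 near] := signature_near (balanced_herm V t) (balanced_unit nr).
by apply: filterS (balanced_near t e0) => u; apply: near; exact: balanced_herm.
Qed.

Lemma form_signatureE u : sin (pi * u) != 0 ->
  form_signature u = Num.sg (sin (pi * u)) * signature (balanced_form V u).
Proof.
move=> s0; rewrite /form_signature seifert_form_balanced.
rewrite signature_scale ?balanced_herm //.
  by rewrite sgrM gtr0_sg // mul1r.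
by rewrite mulf_neq0 // pnatr_eq0.
Qed.

Lemma sg_sin_near t : sin (pi * t) != 0 ->
  \forall u \near t, Num.sg (sin (pi * u)) = Num.sg (sin (pi * t)).
Proof.
have cs := @scaled_cvg sin (@continuous_sin R) t.
case: (ltgtP (sin (pi * t)) 0) => // s0 _.
  by apply: filterS (cvgr_lt _ cs _ s0) => u u0; rewrite !ltr0_sg.
by apply: filterS (cvgr_gt _ cs _ s0) => u u0; rewrite !gtr0_sg.
Qed.

Lemma form_signature_near t : ~~ root D (circle t) -> circle t != 1 ->
  \forall u \near t, form_signature u = form_signature t.
Proof.
move=> nr /sin_neq0 s0.
apply: filterS2 (sg_sin_near s0) (balanced_signature_near nr) => u es eb.
have u0 : sin (pi * u) != 0 by rewrite -sgr_eq0 es sgr_eq0.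
rewrite (form_signatureE u0) (form_signatureE s0) es.
exact (congr1 (GRing.mul (Num.sg (sin (pi * t)))) eb).
Qed.

(** Breaks can only occur at 1 and at roots of the Alexander polynomial. *)
Lemma form_signature_step t :
  \forall u \near t^', \forall v \near u, form_signature v = form_signature u.
Proof.
apply: filterS2 (circle_roots_isolated t alexander_neq0) (circle_avoids t 1) => u.
exact: form_signature_near.
Qed.

(** At 1 the balanced form is a multiple of V - V^T, so transposition, which
    preserves the signature, changes its sign. *)
Lemma balanced_signature_at1 t : circle t = 1 -> signature (balanced_form V t) = 0.
Proof.
move=> c1.
have eT : (balanced_form V t)^T = - balanced_form V t.
  apply/matrixP => i j; rewrite !mxE conj_zeta c1 rmorph1; ring.
have := signature_tr (balanced_herm V t); rewrite eT signatureN ?balanced_herm //.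
by move: (signature _) => s; lra.
Qed.

(** The balanced form is nonsingular at 1, so its signature stays 0 nearby; the
    factor 2 sin(pi u) can only change its sign. *)
Lemma form_signature_near1 t : circle t = 1 ->
  \forall u \near t^', form_signature u = 0.
Proof.
move=> c1.
have nr : ~~ root D (circle t) by rewrite c1 rootE alexander_at1 oner_eq0.
apply: filterS2 (circle_avoids t 1) (nbhs_dnbhs (balanced_signature_near nr)) => u u1 eb.
by rewrite (form_signatureE (sin_neq0 u1)) eb (balanced_signature_at1 c1) mulr0.
Qed.

Lemma lims_at1 t : circle t = 1 ->
  rlim form_signature t = 0 /\ llim form_signature t = 0.
Proof.
move=> /form_signature_near1 /near_dnbhs_sides[l r].
by split; [exact: rlim_cst|exact: llim_cst].
Qed.

(** At 1, where the Seifert form degenerates, both sides are 0. *)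
Lemma sides_agree t : ~~ root D (circle t) ->
  rlim form_signature t = llim form_signature t.
Proof.
move=> nr; have [c1|c1] := eqVneq (circle t) 1.
  by have [-> ->] := lims_at1 c1.
by have [-> ->] := lims_cst (form_signature_near nr c1).
Qed.

Lemma circle0 : circle (0 : R) = 1.
Proof. by rewrite /circle mulr0 cos0 sin0. Qed.

Lemma sigma_midvalue : sigma V = midvalue form_signature :> (R -> R).
Proof. by []. Qed.

Lemma jumpE t : jump V t = 2^-1 * (rlim form_signature t - llim form_signature t).
Proof.
rewrite /jump sigma_midvalue lim_midvalue_right ?lim_midvalue_left //;
  exact: form_signature_step.
Qed.

Lemma seifert_form_herm u : seifert_form V (circle u) \is hermsymmx.
Proof.
rewrite seifert_form_balanced hermitianZ ?balanced_herm //.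
by apply/CrealP; exact: conj_real.
Qed.

Lemma form_signature_values u : @signature_values R n (form_signature u).
Proof. exact/signature_in_values/seifert_form_herm. Qed.

Lemma rlim_values t : @signature_values R n (rlim form_signature t).
Proof.
have [u <-] := @filter_ex _ t^'+ _ _ (rlimP form_signature_step t).
exact: form_signature_values.
Qed.

Lemma llim_values t : @signature_values R n (llim form_signature t).
Proof.
have [u <-] := @filter_ex _ t^'- _ _ (llimP form_signature_step t).
exact: form_signature_values.
Qed.

Lemma finite_lims (h : R -> R -> R) (S : set R) : finite_set
  [set h (rlim form_signature t) (llim form_signature t) | t in S].
Proof.
apply: sub_finite_set (finite_image2 h (@finite_signature_values R n)
  (@finite_signature_values R n)).
move=> _ [t _ <-]; exists (rlim form_signature t); first exact: rlim_values.
by exists (llim form_signature t); first exact: llim_values.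
Qed.
End SeifertSignature.

(** * Irreducible symmetric factors *)

Section Reciprocal.
Variable K : fieldType.
Implicit Types p : {poly K}.

(** x^(deg p) p(1/x); a polynomial is symmetric when it equals its reciprocal. *)
Definition reciprocal p : {poly K} := \poly_(i < size p) p`_((size p).-1 - i).

Lemma coef_reciprocal p i :
  (reciprocal p)`_i = if (i < size p)%N then p`_((size p).-1 - i) else 0.
Proof. exact: coef_poly. Qed.

Lemma horner_reciprocal p x : x != 0 ->
  (reciprocal p).[x] = x ^+ (size p).-1 * p.[x^-1].
Proof.
move=> x0; rewrite horner_poly horner_coef mulr_sumr.
rewrite (reindex_inj rev_ord_inj) /=; apply: eq_bigr => i _.
have le_i : (i <= (size p).-1)%N by rewrite -ltnS (ltn_predK (ltn_ord i)).
have -> : (size p - i.+1 = (size p).-1 - i)%N by rewrite subnS -predn_sub.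
by rewrite subKn // mulrCA exprVn -expfB_cond // (negPf x0).
Qed.

Lemma reciprocal_neq0 p : p != 0 -> reciprocal p != 0.
Proof.
move=> p0; apply: contra_neq p0 => /(congr1 (coefp 0)).
rewrite /= coef_reciprocal coef0 subn0; case: ifP => [_ /eqP|/negbT].
  by rewrite lead_coef_eq0 => /eqP.
by rewrite lt0n negbK size_poly_eq0 => /eqP.
Qed.
End Reciprocal.

Lemma map_reciprocal (K L : fieldType) (f : {rmorphism K -> L}) (p : {poly K}) :
  map_poly f (reciprocal p) = reciprocal (map_poly f p).
Proof.
apply/polyP => i; rewrite coef_map !coef_reciprocal size_map_poly coef_map.
by case: ifP => _ //; exact: rmorph0.
Qed.

Lemma irreducible_root_dvdp (K L : fieldType) (f : {rmorphism K -> L})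
  (p q : {poly K}) (x : L) : irreducible_poly p ->
  root (map_poly f p) x -> root (map_poly f q) x -> p %| q.
Proof.
move=> irr px qx; apply: contraT; rewrite -irreducible_poly_coprime //.
rewrite -(coprimep_map f) => cop.
by have := coprimep_root cop px; rewrite (eqP qx) eqxx.
Qed.

Section Factor.
Local Open Scope sesquilinear_scope.
Variables (R : realType) (n : nat) (V : 'M[int]_n).
Hypothesis hV : seifert_matrix V.

(** The minimal polynomial p of z = e^(2 pi i t) over the rationals divides the
    Alexander polynomial.  As 1/z is the conjugate of z, it is a root of p too,
    so p divides its own reciprocal, and the two are proportional.  Both have
    the same value at 1, and p(1) is nonzero because it is a factor of
    Delta(1) = 1, so they are equal. *)
Lemma exists_factor (t : R) : root (alexander_complex R V) (circle t) ->
  exists2 delta, admissible_factor R V delta & circle_roots delta t.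
Proof.
move=> rt; set z := circle t.
pose D : {poly rat} := map_poly intr (alexander_poly V).
have DE : map_poly (@ratr R[i]) D = alexander_complex R V.
  by rewrite -map_poly_comp; apply: eq_map_poly => m /=; rewrite ratr_int.
have D1 : D.[1] = 1.
  apply: (fmorph_inj (@ratr R[i])).
  by rewrite -horner_map /= rmorph1 DE alexander_at1.
have D0 : D != 0 by apply: contra_eq_neq D1 => ->; rewrite horner0 eq_sym oner_eq0.
have Drt : root (map_poly ratr D) z by rewrite DE.
have int_z : integralOver (@ratr R[i]) z.
  by apply/integral_algebraic; exists D.
have dec : decidable_embedding (@ratr R[i]).
  by move=> y; apply: pselect.
have [p [_ pz irr]] := minPoly_decidable_closure dec int_z.
have pD : p %| D by apply: irreducible_root_dvdp irr pz Drt.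
exists p => //; split=> //; last by exists t.
have p1 : p.[1] != 0.
  have /dvdpP[q qE] := pD; move: D1; rewrite qE hornerM => h.
  by apply: contra_eq_neq h => ->; rewrite mulr0 eq_sym oner_eq0.
have z0 : z != 0 by rewrite -normr_gt0 norm_circle.
have rz : root (map_poly ratr (reciprocal p)) z.
  rewrite map_reciprocal rootE horner_reciprocal // circle_inv.
  have -> : map_poly ratr p = map_poly Num.conj (map_poly (@ratr R[i]) p).
    by rewrite -map_poly_comp; apply: eq_map_poly => m /=; rewrite fmorph_rat.
  by rewrite horner_map (eqP pz) rmorph0 mulr0.
have pr : p %| reciprocal p by apply: irreducible_root_dvdp irr pz rz.
have rp0 : reciprocal p != 0 by rewrite reciprocal_neq0 // irredp_neq0.
have : reciprocal p %= p.
  rewrite eqp_sym -dvdp_size_eqp // eqn_leq dvdp_leq //=.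
  exact: size_poly.
move=> /eqpf_eq[c c0 rE].
suff c1 : c = 1 by rewrite /symmetric_poly -/(reciprocal p) rE c1 scale1r.
have := horner_reciprocal p (oner_neq0 rat).
by rewrite rE hornerZ invr1 expr1n => /(mulIf p1).
Qed.
End Factor.

(** * Extrema and crossing bounds *)

Section Extrema.
Variable R : realType.
Implicit Types (S : set R) (x m : R).

Lemma max_of_mem0 S : max_of S = 0 \/ S (max_of S).
Proof.
by rewrite /max_of; case: xgetP => [m _ [Sm _]|_]; [right | left].
Qed.

Lemma finite_has_max S : finite_set S -> S !=set0 ->
  exists m, S m /\ ubound S m.
Proof.
move=> /finite_seqP[s ->]; elim: s => [|x s IH] [y ys]; first by move: ys.
have [[z zs]|no] := pselect ([set` s] !=set0); last first.
  exists x; split=> [|w] /=; first by rewrite inE eqxx.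
  by rewrite inE => /orP[/eqP->//|ws]; exfalso; apply: no; exists w.
have [m [ms ub]] := IH (ex_intro _ z zs).
exists (Num.max x m); split=> [|w] /=.
  by rewrite inE; case: leP => _; rewrite ?eqxx // [X in _ || X]ms orbT.
by rewrite inE le_max => /orP[/eqP->|/ub ->]; rewrite ?lexx ?orbT.
Qed.

Lemma max_of_finite S : finite_set S -> S !=set0 ->
  S (max_of S) /\ ubound S (max_of S).
Proof.
by move=> fS S0; apply: (@xgetPex _ 0 (S `&` ubound S)); exact: finite_has_max.
Qed.

Lemma min_of_finite S : finite_set S -> S !=set0 ->
  S (min_of S) /\ lbound S (min_of S).
Proof.
move=> fS [x Sx]; apply: (@xgetPex _ 0 (S `&` lbound S)).
have [m [[y Sy <-] ub]] :=
  finite_has_max (finite_image -%R fS) (ex_intro _ (- x) (ex_intro2 _ _ x Sx erefl)).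
exists y; split=> // z Sz; rewrite -lerN2; apply: ub; by exists z.
Qed.

(** Making the three extrema variables turns the estimates on crossing_bounds
    into linear arithmetic. *)
Definition bounds_of (J s S : R) : R * R :=
  if 0 <= S then
    if s <= J then ((J + S) / 2, (J - s) / 2) else ((J + S) / 2, 0)
  else
    if - S <= J then ((J + S) / 2, (J - s) / 2) else (0, (J - s) / 2).

(** A bound is replaced by 0 only when the corresponding half-sum or
    half-difference is negative. *)
Lemma bounds_of_ge (J s S : R) : 0 <= J -> s <= S ->
  [/\ 0 <= (bounds_of J s S).1, (J + S) / 2 <= (bounds_of J s S).1,
      0 <= (bounds_of J s S).2 & (J - s) / 2 <= (bounds_of J s S).2].
Proof.
move=> J0 sS; rewrite /bounds_of.
by case: (lerP 0 S) => ?; [case: (lerP s J) => ? | case: (lerP (- S) J) => ?];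
  split => /=; lra.
Qed.

Lemma bounds_of_le (J s S a A : R) : a <= 0 -> 0 <= A ->
  J <= (A - a) / 2 -> a <= s -> S <= A ->
  (bounds_of J s S).1 <= ((A - a) / 2 + A) / 2
  /\ (bounds_of J s S).2 <= ((A - a) / 2 - a) / 2.
Proof.
move=> a0 A0 JA sa SA; rewrite /bounds_of.
by case: (lerP 0 S) => ?; [case: (lerP s J) => ? | case: (lerP (- S) J) => ?];
  split => /=; lra.
Qed.
End Extrema.

(** * Comparison of the two unknotting bounds *)

Section Comparison.
Variables (R : realType) (n : nat) (V : 'M[int]_n).
Hypothesis hV : seifert_matrix V.
Implicit Types (t : R) (delta : {poly rat}).

Let sig : R -> R := sigma V.
Let jmp : R -> R := jump V.
Let sigr : R -> R := rlim (form_signature V).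
Let sigl : R -> R := llim (form_signature V).

Let sigE t : sig t = 2^-1 * (sigr t + sigl t). Proof. by []. Qed.
Let jmpE t : jmp t = 2^-1 * (sigr t - sigl t). Proof. exact: jumpE. Qed.

Lemma finite_sigma (S : set R) : finite_set [set sigma V t | t in S].
Proof. exact: (finite_lims hV (fun r l => 2^-1 * (r + l))). Qed.

Lemma finite_jump (S : set R) : finite_set [set `|jump V t| | t in S].
Proof.
rewrite (_ : [set `|jump V t| | t in S] =
  [set (fun r l => `|2^-1 * (r - l)|) (sigr t) (sigl t) | t in S]).
  exact: (finite_lims hV (fun r l => `|2^-1 * (r - l)|)).
by apply: eq_imagel => t _; rewrite (jumpE hV).
Qed.

Let A : R := max_of (range sig).
Let a : R := min_of (range sig).

Let range_sig : range sig !=set0. Proof. by exists (sig 0), 0. Qed.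

Lemma sigma_le t : sig t <= A.
Proof. by have [_] := max_of_finite (finite_sigma _) range_sig; apply; exists t. Qed.

Lemma sigma_ge t : a <= sig t.
Proof. by have [_] := min_of_finite (finite_sigma _) range_sig; apply; exists t. Qed.

Lemma sigma0 : sig 0 = 0.
Proof.
by rewrite sigE /sigr /sigl; have [-> ->] := lims_at1 hV (circle0 R); rewrite addr0 mulr0.
Qed.

Let A0 : 0 <= A. Proof. by rewrite -sigma0 sigma_le. Qed.
Let a0 : a <= 0. Proof. by rewrite -sigma0 sigma_ge. Qed.

Let r_bounds t : a <= sigr t <= A.
Proof.
rewrite /sigr; have [u <-] := rlim_midvalue (form_signature_step hV) t.
by rewrite sigma_le sigma_ge.
Qed.

Let l_bounds t : a <= sigl t <= A.
Proof.
rewrite /sigl; have [u <-] := llim_midvalue (form_signature_step hV) t.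
by rewrite sigma_le sigma_ge.
Qed.

Lemma jump_le t : `|jmp t| <= (A - a) / 2.
Proof.
rewrite jmpE ler_norml; have /andP[? ?] := r_bounds t; have /andP[? ?] := l_bounds t.
by apply/andP; split; lra.
Qed.

(** If c bounds both one-sided limits on the same side and their mean at t1 is
    c, then both are equal to c at t1, whereas they vanish at 0. *)
Lemma extremum_at_root (c t1 : R) : c != 0 -> sig t1 = c ->
  (forall t, sigr t <= c /\ sigl t <= c) \/ (forall t, c <= sigr t /\ c <= sigl t) ->
  exists delta t, [/\ admissible_factor R V delta, circle_roots delta t &
    sigr t = c \/ sigl t = c].
Proof.
move=> c0 sc ext.
have [r0 l0] := lims_at1 hV (circle0 R).
have rt1 : sigr t1 = c.
  by move: sc; rewrite sigE; case: ext => /(_ t1)[]; lra.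
have [t [St ct]] := @exists_break _ _ (form_signature_step hV)
  (fun t => root (alexander_complex R V) (circle t)) c 0 t1
  (fun t => fun nr => sides_agree hV (introN idP nr))
  (fun e => elimN eqP c0 (etrans (esym e) r0))
  (fun e => elimN eqP c0 (etrans (esym e) l0)) rt1.
have [delta ad rd] := exists_factor hV St.
by exists delta, t.
Qed.

Section OneFactor.
Variable delta : {poly rat}.
Hypothesis ad : admissible_factor R V delta.

Let J := max_jump R V delta : R.
Let s := min_sigma R V delta : R.
Let S := max_sigma R V delta : R.

Let roots0 : exists t : R, circle_roots delta t.
Proof. by case: ad. Qed.

Let img0 (f : R -> R) : [set f t | t in circle_roots delta] !=set0.
Proof. by have [t dt] := roots0; exists (f t), t. Qed.

Let JP : [set `|jmp t| | t in circle_roots delta] J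
  /\ ubound [set `|jmp t| | t in circle_roots delta] J.
Proof. exact: max_of_finite (finite_jump _) (img0 (fun t => `|jmp t|)). Qed.

Let sP : [set sig t | t in circle_roots delta] s
  /\ lbound [set sig t | t in circle_roots delta] s.
Proof. exact: min_of_finite (finite_sigma _) (img0 sig). Qed.

Let SP : [set sig t | t in circle_roots delta] S
  /\ ubound [set sig t | t in circle_roots delta] S.
Proof. exact: max_of_finite (finite_sigma _) (img0 sig). Qed.

Lemma crossing_bounds_mem : [set bounds_of p.1.1 p.1.2 p.2 | p in
    range (fun t => `|jmp t|) `*` range sig `*` range sig]
  (crossing_bounds R V delta).
Proof.
exists ((J, s), S) => //.
have [[t1 _ e1] _] := JP; have [[t2 _ e2] _] := sP; have [[t3 _ e3] _] := SP.
by split; [split|] => /=; [exists t1|exists t2|exists t3].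
Qed.

Lemma crossing_bounds_le :
  (crossing_bounds R V delta).1 <= ((A - a) / 2 + A) / 2
  /\ (crossing_bounds R V delta).2 <= ((A - a) / 2 - a) / 2.
Proof.
apply: (@bounds_of_le _ J s S) => //.
- by have [[t _ <-] _] := JP; exact: jump_le.
- by have [[t _ <-] _] := sP; exact: sigma_ge.
- by have [[t _ <-] _] := SP; exact: sigma_le.
Qed.

Lemma crossing_bounds_ge t : circle_roots delta t ->
  [/\ 0 <= (crossing_bounds R V delta).1,
      (`|jmp t| + sig t) / 2 <= (crossing_bounds R V delta).1,
      0 <= (crossing_bounds R V delta).2 &
      (`|jmp t| - sig t) / 2 <= (crossing_bounds R V delta).2].
Proof.
move=> dt.
have Jt : `|jmp t| <= J by have [_] := JP; apply; exists t.
have st : s <= sig t by have [_] := sP; apply; exists t.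
have St : sig t <= S by have [_] := SP; apply; exists t.
have [p1 p2 p3 p4] := @bounds_of_ge _ J s S (le_trans (normr_ge0 _) Jt) (le_trans st St).
by split => //; [apply: le_trans p2|apply: le_trans p4]; lra.
Qed.
End OneFactor.

Let N : set R := [set (crossing_bounds R V delta).1 | delta in admissible_factor R V].
Let P : set R := [set (crossing_bounds R V delta).2 | delta in admissible_factor R V].

(** Admissible factors are stable under nonzero rational scaling, so finiteness
    must come from the values of the bounds and not from the factors. *)
Let finite_bounds : finite_set [set bounds_of p.1.1 p.1.2 p.2 | p in
  range (fun t => `|jmp t|) `*` range sig `*` range sig].
Proof.
apply: finite_image; apply: finite_setX; last exact: finite_sigma.
by apply: finite_setX; [exact: finite_jump | exact: finite_sigma].
Qed.

Let finite_N : finite_set N.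
Proof.
apply: sub_finite_set (finite_image fst finite_bounds).
move=> _ [delta ad <-]; exists (crossing_bounds R V delta) => //.
exact: crossing_bounds_mem.
Qed.

Let finite_P : finite_set P.
Proof.
apply: sub_finite_set (finite_image snd finite_bounds).
move=> _ [delta ad <-]; exists (crossing_bounds R V delta) => //.
exact: crossing_bounds_mem.
Qed.

Let N_ge0 : 0 <= max_of N.
Proof.
have [->//|[delta ad <-]] := max_of_mem0 N.
by have [_ _ _ [t dt]] := ad; have [] := crossing_bounds_ge ad dt.
Qed.

Let P_ge0 : 0 <= max_of P.
Proof.
have [->//|[delta ad <-]] := max_of_mem0 P.
by have [_ _ _ [t dt]] := ad; have [] := crossing_bounds_ge ad dt.
Qed.

Let N_ge : A / 2 <= max_of N.
Proof.
have [AE|An0] := eqVneq A 0; first by rewrite AE mul0r; exact: N_ge0.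
have [[t1 _ e1] _] := max_of_finite (finite_sigma _) range_sig.
have ext : forall t, sigr t <= A /\ sigl t <= A.
  by move=> t; have /andP[_ ?] := r_bounds t; have /andP[_ ?] := l_bounds t.
have [delta [t [ad dt ct]]] := extremum_at_root An0 e1 (or_introl ext).
have [_ ge _ _] := crossing_bounds_ge ad dt.
have [_ ub] := max_of_finite finite_N (ex_intro _ _ (ex_intro2 _ _ delta ad erefl)).
apply: le_trans (ub _ (ex_intro2 _ _ delta ad erefl)); apply: le_trans ge.
have := ler_norm (jmp t); have := ler_norm (- jmp t); rewrite normrN sigE jmpE.
by case: ct => ->; lra.
Qed.

Let P_ge : - a / 2 <= max_of P.
Proof.
have [aE|an0] := eqVneq a 0; first by rewrite aE oppr0 mul0r; exact: P_ge0.
have [[t1 _ e1] _] := min_of_finite (finite_sigma _) range_sig.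
have ext : forall t, a <= sigr t /\ a <= sigl t.
  by move=> t; have /andP[? _] := r_bounds t; have /andP[? _] := l_bounds t.
have [delta [t [ad dt ct]]] := extremum_at_root an0 e1 (or_intror ext).
have [_ _ _ ge] := crossing_bounds_ge ad dt.
have [_ ub] := max_of_finite finite_P (ex_intro _ _ (ex_intro2 _ _ delta ad erefl)).
apply: le_trans (ub _ (ex_intro2 _ _ delta ad erefl)); apply: le_trans ge.
have := ler_norm (jmp t); have := ler_norm (- jmp t); rewrite normrN sigE jmpE.
by case: ct => ->; lra.
Qed.

Lemma u1_le_u2 : u1 R V <= u2 R V.
Proof.
by have := N_ge; have := P_ge; rewrite /u1 /u2 -/N -/P -/A -/a; lra.
Qed.

Lemma u2_le_twice_u1 : u2 R V <= 2 * u1 R V.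
Proof.
have := A0; have := a0.
have NA : max_of N <= ((A - a) / 2 + A) / 2.
  have [->|[delta ad <-]] := max_of_mem0 N; last by have [] := crossing_bounds_le ad.
  by have := A0; have := a0; lra.
have PA : max_of P <= ((A - a) / 2 - a) / 2.
  have [->|[delta ad <-]] := max_of_mem0 P; last by have [] := crossing_bounds_le ad.
  by have := A0; have := a0; lra.
by rewrite /u1 /u2 -/N -/P -/A -/a; lra.
Qed.
End Comparison.

Theorem theorem14 (R : realType) (n : nat) (V : 'M[int]_n)
    (hV : seifert_matrix V) :
  u1 R V <= u2 R V /\ u2 R V <= 2 * u1 R V.
Proof. by split; [exact: u1_le_u2 | exact: u2_le_twice_u1]. Qed.
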